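(* Let $T>0$, let $k\ge 2$ be an integer, let $\alpha\in(0,1]$, and let $f\in C^{k,\alpha}[0,T]$ be such that $f\ge 0$. Assume that $f$ has at least one zero in $[0,T]$. If $f'(x)=\cdots=f^{(k)}(x)=0$ whenever $f(x)=0$, then $f^{\mu}$ is differentiable for $\mu\in(1/(k+\alpha),1)$. If moreover $N(x,y)/D(x,y)$ is bounded for $(x,y)\in\{t\in[0,T]:\ f(t)=0\}\times\{t\in[0,T]:\ f(t)>0\}$, where $$N(x,y)=(y-x)^{k-1}\int_0^1(1-s)^{k-2}f^{(k)}(sy+(1-s)x)\,ds,$$ $$D(x,y)=\left((y-x)^{k}\int_0^1(1-s)^{k-1}f^{(k)}(sy+(1-s)x)\,ds\right)^{(k+\alpha-1)/(k+\alpha)},$$ then $(f^{\mu})'$ is Hölder continuous with exponent $\beta=\mu(k+\alpha)-1$ at $x$ such that $f(x)=0$ (if $\beta\le 1$). $(f^{\mu})'$ is Lipschitz continuous at $x$ if $f(x)>0$.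
   Context: $C^{k}[a,b]$ is the space of real functions differentiable up to order $k$ such that the derivatives of order $k$ are continuous on $[a,b]$. $C^{k,\alpha}[a,b]$ is the space of functions $f\in C^k[a,b]$ such that $f^{(k)}$ is Hölder continuous with exponent $\alpha\in(0,1]$ in $[a,b]$, i.e. $\sup\{|f^{(k)}(x)-f^{(k)}(y)||x-y|^{-\alpha}:\ x\ne y,\ x,y\in[a,b]\}<\infty$. A function $g:[a,b]\to\mathbb{R}$ is Hölder continuous with exponent $\gamma\in(0,1]$ at a point $x\in[a,b]$ if $\sup\{|g(y)-g(x)||y-x|^{-\gamma}:\ y\ne x,\ y\in[a,b]\}<\infty$. Lipschitz continuous at $x$ means Hölder continuous with exponent $1$ at $x$. Here $[a,b]=[0,T]$. $f^{\mu}$ denotes the function $x\mapsto f(x)^{\mu}$. The quantities $N(x,y)$ and $D(x,y)$ are considered for $x\in[0,T]$ with $f^{(j)}(x)=0$ for $j=0,\dots,k$, and $y\in[0,T]$; for such $x$ the quantity raised to the power $(k+\alpha-1)/(k+\alpha)$ in $D(x,y)$ equals $(k-1)!\,f(y)\ge 0$, so $D(x,y)$ is well defined, and it is positive when $f(y)>0$. *)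

(* Defs.v *)
From HB Require Import structures.
From mathcomp Require Import all_boot all_order all_algebra.
From mathcomp Require Import all_classical all_reals all_analysis.
Import Order.TTheory GRing.Theory Num.Theory.
Import numFieldNormedType.Exports.

Set Implicit Arguments.
Unset Strict Implicit.
Unset Printing Implicit Defensive.

Local Open Scope classical_set_scope.
Local Open Scope ring_scope.

(* A function on [a, b] is represented by a total function R -> R. Derivatives
   at a point of [a, b] are limits along [a, b], hence one-sided at the
   endpoints, so the values of f outside [a, b] never matter. *)

Definition diff_quotient (R : realType) (f : R -> R) (x y : R) : R :=
  (f y - f x) / (y - x).

Definition derivable_in (R : realType) (a b : R) (f : R -> R) (x : R) : Prop :=
  cvg (diff_quotient f x @ within `[a, b] x^').

(* Meaningful when a <= x <= b, a < b and [derivable_in a b f x]. *)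
Definition derive_in (R : realType) (a b : R) (f : R -> R) (x : R) : R :=
  lim (diff_quotient f x @ within `[a, b] x^').

Definition nderive_in (R : realType) (a b : R) (n : nat) (f : R -> R) :
    R -> R :=
  iter n (derive_in a b) f.

Definition Ck (R : realType) (k : nat) (a b : R) (f : R -> R) : Prop :=
  (forall j, (j < k)%N -> forall x, x \in `[a, b] ->
     derivable_in a b (nderive_in a b j f) x) /\
  {within `[a, b], continuous (nderive_in a b k f)}.

Definition hoelder_continuous (R : realType) (a b gamma : R) (g : R -> R) :
    Prop :=
  has_ubound [set `|g p.1 - g p.2| * `|p.1 - p.2| `^ (- gamma) | p in
    [set p : R * R | [/\ p.1 != p.2, p.1 \in `[a, b] & p.2 \in `[a, b]]]].

Definition Ckalpha (R : realType) (k : nat) (alpha a b : R) (f : R -> R) :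
    Prop :=
  Ck k a b f /\ hoelder_continuous a b alpha (nderive_in a b k f).

(* The supremum is over all of [a, b], not over a neighbourhood of x. *)
Definition hoelder_continuous_at (R : realType) (a b gamma : R) (g : R -> R)
    (x : R) : Prop :=
  has_ubound [set `|g y - g x| * `|y - x| `^ (- gamma) | y in
    [set y : R | y != x /\ y \in `[a, b]]].

Definition lipschitz_continuous_at (R : realType) (a b : R) (g : R -> R)
    (x : R) : Prop :=
  hoelder_continuous_at a b 1 g x.

(* N(x, y) and D(x, y), with g standing for the k-th derivative of f. *)
Definition Nterm (R : realType) (k : nat) (g : R -> R) (x y : R) : R :=
  (y - x) ^+ (k - 1) *
  \int[lebesgue_measure]_(s in `[0, 1])
     ((1 - s) ^+ (k - 2) * g (s * y + (1 - s) * x)).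

Definition Dterm (R : realType) (k : nat) (alpha : R) (g : R -> R) (x y : R) :
    R :=
  ((y - x) ^+ k *
   \int[lebesgue_measure]_(s in `[0, 1])
      ((1 - s) ^+ (k - 1) * g (s * y + (1 - s) * x)))
  `^ ((k%:R + alpha - 1) / (k%:R + alpha)).

(* Main.v *)
Require Import Defs.
From HB Require Import structures.
From mathcomp Require Import all_boot all_order all_algebra.
From mathcomp Require Import all_classical all_reals all_analysis.
From mathcomp Require Import ring lra.
Import Order.TTheory GRing.Theory Num.Theory.
Import numFieldNormedType.Exports.

Set Implicit Arguments.
Unset Strict Implicit.
Unset Printing Implicit Defensive.

Local Open Scope classical_set_scope.
Local Open Scope ring_scope.

(** Write K = k + alpha. Taylor's formula with integral remainder at a zero x,
    where the derivatives of f of order at most k vanish, says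
    [(k-1)! f(y) = (y-x)^k int_0^1 (1-s)^(k-1) f^(k)(sy+(1-s)x) ds], and the
    same formula one order lower, applied to f', says that N(x,y) is
    (k-2)! f'(y) (lemma [taylor_integral]). Two estimates follow.

    - Growth: f^(k) vanishes at x and is alpha-Hoelder, so
      f(y) <= H |y-x|^K for every zero x ([flat_growth]). Hence the
      difference quotient of f^mu at x is O(|y-x|^(mu K - 1)), and f^mu has
      derivative 0 at each zero of f ([is_derive_in_powR_flat]). At the other
      points the chain rule gives (f^mu)' = mu f^(mu-1) f'.
    - Slope: D(x,y) is ((k-1)! f(y))^((K-1)/K), so the boundedness of N/D is
      the inequality |f'| <= C f^(1-1/K) ([bounded_quotient_deriv_le]); one
      fixed zero x is enough to derive it.

    Put beta = mu K - 1. The slope estimate yields |(f^mu)'| <= C' f^(beta/K)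
    on the whole interval, and the growth estimate at a zero x turns this into
    |(f^mu)'(y)| <= C'' |y-x|^beta, the Hoelder estimate at x. It also bounds
    (f^mu)' globally. Where f(x) > 0, the function mu f^(mu-1) f' is
    differentiable, because k >= 2, which controls its increments near x;
    away from x the global bound suffices ([is_derive_in_lipschitz]). *)

(** * Derivatives along a compact interval *)

(** Relational counterpart of [derive_in], whose value is only meaningful once
    the limit is known to exist. *)
Definition is_derive_in (R : realType) (a b : R) (f : R -> R) (x l : R) :
    Prop :=
  diff_quotient f x @ within `[a, b] x^' --> l.

(** This makes the derivative at x along [a, b] unique, endpoints included. *)
Lemma within_itv_dnbhs_proper (R : realType) (a b x : R) : a < b ->
  x \in `[a, b] -> ProperFilter (within `[a, b] x^').
Proof.
move=> ab; rewrite in_itv/= => /andP[ax xb].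
apply: Build_ProperFilter_ex => U /nbhs_ballP[e /= e0 eU].
have [xb'|bx] := ltP x b.
- pose y := Num.min b (x + e / 2).
  have xy : x < y by rewrite lt_min xb' ltrDl divr_gt0.
  exists y; apply: eU.
  + rewrite /ball/= distrC gtr0_norm ?subr_gt0// ltrBlDl.
    by rewrite gt_min ltrD2l ltr_pdivrMr// ltr_pMr// ltr1n orbT.
  + by rewrite gt_eqF.
  + by rewrite /= in_itv/= (le_trans ax (ltW xy))/= ge_min lexx.
- pose y := Num.max a (x - e / 2).
  have ax' : a < x by apply: lt_le_trans bx.
  have yx : y < x by rewrite gt_max ax' ltrBlDr ltrDl divr_gt0.
  exists y; apply: eU.
  + rewrite /ball/= gtr0_norm ?subr_gt0// ltrBlDr -ltrBlDl.
    by rewrite lt_max ltrD2l ltrN2 ltr_pdivrMr// ltr_pMr// ltr1n orbT.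
  + by rewrite lt_eqF.
  + by rewrite /= in_itv/= (ltW (lt_le_trans yx xb)) le_max lexx.
Qed.

(** The difference quotient written in the endpoint y = h + x instead of the
    increment h: this links [diff_quotient] to the two-sided derivative. *)
Lemma is_deriveP (R : realType) (f : R -> R) (x l : R) :
  is_derive x 1 f l <-> diff_quotient f x @ x^' --> l.
Proof.
have dE y (P : set R) :
    (\forall z \near y^', P z) = (\forall z \near y, z != y -> P z) by [].
have E (m : R) : (h^-1 *: ((f \o shift x) (h *: 1) - f x) @[h --> 0^'] --> m)
     <-> (diff_quotient f x @ x^' --> m).
  split=> /cvgrPdist_le H; apply/cvgrPdist_le => e e0; have := H e e0.
    rewrite !dE (near_shift 0 x).
    apply: filterS => h /= H1; rewrite subr0 => H2.
    have h0 : h != 0 by apply: contraNneq H2 => ->; rewrite add0r.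
    have := H1 h0; rewrite /diff_quotient addrK.
    by rewrite [h *: 1]mulr1 [_ *: _]mulrC.
  rewrite !dE (near_shift 0 x); apply: filterS => h /=; rewrite subr0 => H1 h0.
  have H2 : h + x != x by rewrite -subr_eq0 addrK.
  have := H1 H2; rewrite /diff_quotient addrK.
  by rewrite [h *: 1]mulr1 [_ *: _]mulrC.
split=> [[df <-]|H0]; first exact: (E _).1.
have H := (E _).2 H0.
have : derivable f x 1 by apply/cvg_ex; exists l.
by move=> df; split => //; exact: (cvg_lim _ H).
Qed.

Lemma is_derive_in_interior (R : realType) (a b : R) (f : R -> R) (x l : R) :
  x \in `]a, b[ -> is_derive_in a b f x l -> is_derive x 1 f l.
Proof.
move=> xab fl; apply/is_deriveP; apply: cvg_trans fl.
apply: cvg_app => U /= nU.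
have nU' : \forall y \near x, y != x -> y \in `[a, b] -> U y by [].
suff : \forall y \near x, y != x -> U y by [].
near=> y => yx; apply: (near nU') => //.
apply: subset_itv_oo_cc; near: y; exact: near_in_itvoo.
Unshelve. all: by end_near. Qed.

(** Chain rule. The outer difference quotient, completed by its limit d at f x,
    is continuous at f x, and the difference quotient of the composite is a
    product with it even at points where f y = f x. *)
Lemma is_derive_in_comp (R : realType) (a b : R) (h f : R -> R) (x d l : R) :
  f y @[y --> within `[a, b] (nbhs x)] --> f x ->
  is_derive (f x) 1 h d -> is_derive_in a b f x l ->
  is_derive_in a b (h \o f) x (d * l).
Proof.
move=> fc /is_deriveP hd fd.
pose q z := if z == f x then d else diff_quotient h (f x) z.
have qc : q z @[z --> f x] --> d.
  apply/cvgrPdist_le => e e0.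
  move/cvgrPdist_le: hd => /(_ _ e0).
  rewrite near_withinE; apply: filterS => z; rewrite /q.
  by case: eqP => [_ _|/eqP zf]; [rewrite subrr normr0 ltW|exact].
rewrite /is_derive_in.
have -> : diff_quotient (h \o f) x = (q \o f) \* diff_quotient f x.
  apply/funext => y; rewrite /diff_quotient/= /q /diff_quotient.
  have [->|fE] := eqVneq (f y) (f x); first by rewrite !subrr !(mul0r,mulr0).
  by rewrite mulrA divfK// subr_eq0.
apply: cvgM => //; apply: cvg_comp qc.
apply: cvg_trans fc; apply: cvg_app => U nU.
suff : \forall y \near x, y != x -> y \in `[a, b] -> U y by [].
have nU' : \forall y \near x, y \in `[a, b] -> U y by [].
by apply: filterS nU' => y Uy _.
Qed.

Lemma is_derive_in_cst (R : realType) (a b c x : R) :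
  is_derive_in a b (cst c) x 0.
Proof.
rewrite /is_derive_in (_ : diff_quotient _ _ = cst 0); first exact: cvg_cst.
by apply/funext => y; rewrite /diff_quotient subrr mul0r.
Qed.

Lemma is_derive_in_cvg (R : realType) (a b : R) (f : R -> R) (x l : R) :
  is_derive_in a b f x l -> f y @[y --> within `[a, b] (nbhs x)] --> f x.
Proof.
move=> fl; have H : f y @[y --> within `[a, b] x^'] --> f x.
  rewrite [X in _ --> X](_ : f x = l * (x - x) + f x); last first.
    by rewrite subrr mulr0 add0r.
  have H : (diff_quotient f x \* (fun y => y - x)) y + f x
      @[y --> within `[a, b] x^'] --> l * (x - x) + f x.
    apply: cvgD; last exact: cvg_cst.
    apply: cvgM => //; apply: cvgB; last exact: cvg_cst.
    apply: cvg_within_filter; exact: nbhs_dnbhs.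
  apply: cvg_trans H; apply: near_eq_cvg.
  suff : \forall y \near x, y != x -> y \in `[a, b] ->
      (diff_quotient f x \* (fun y => y - x)) y + f x = f y by [].
  near=> y => yx _; rewrite /diff_quotient/= divfK ?subrK//.
  by rewrite subr_eq0.
move=> U nU; have /= H' := H U nU.
have H1 : \forall y \near x, y != x -> y \in `[a, b] -> U (f y) by [].
suff : \forall y \near x, y \in `[a, b] -> U (f y) by [].
apply: filterS H1 => y H2 yab; have [->|yx] := eqVneq y x; last exact: H2.
exact: nbhs_singleton.
Unshelve. all: by end_near. Qed.

Lemma is_derive_inM (R : realType) (a b : R) (f g : R -> R) (x l m : R) :
  is_derive_in a b f x l -> is_derive_in a b g x m ->
  is_derive_in a b (f \* g) x (l * g x + f x * m).
Proof.
move=> fl gm; rewrite /is_derive_in.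
have -> : diff_quotient (f \* g) x =
    (fun y => diff_quotient f x y * g y + f x * diff_quotient g x y).
  apply/funext => y; rewrite /diff_quotient/= mulrAC mulrA -mulrDl.
  by congr (_ / _); rewrite mulrBl mulrBr addrA subrK.
apply: cvgD; apply: cvgM => //; last exact: cvg_cst.
have := is_derive_in_cvg gm; apply: cvg_trans.
apply: cvg_app => U nU.
suff : \forall y \near x, y != x -> y \in `[a, b] -> U y by [].
have nU' : \forall y \near x, y \in `[a, b] -> U y by [].
by apply: filterS nU' => y Uy _.
Qed.

Lemma near_is_derive_in (R : realType) (a b : R) (f g : R -> R) (x l : R) :
  (\forall y \near x, y \in `[a, b] -> f y = g y) -> f x = g x ->
  is_derive_in a b f x l -> is_derive_in a b g x l.
Proof.
move=> fg fgx; apply: cvg_trans; apply: near_eq_cvg.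
suff : \forall y \near x, y != x -> y \in `[a, b] ->
   diff_quotient f x y = diff_quotient g x y by [].
apply: filterS fg => y fgy yx yab; by rewrite /diff_quotient fgx fgy.
Qed.

Lemma is_derive_inP (R : realType) (a b : R) (f : R -> R) (x l : R) :
  a < b -> x \in `[a, b] -> is_derive_in a b f x l ->
  derivable_in a b f x /\ derive_in a b f x = l.
Proof.
move=> ab xab fl; have := within_itv_dnbhs_proper ab xab => P.
by split; [apply/cvg_ex; exists l|exact: cvg_lim fl].
Qed.

(** Lipschitz continuity at x is global on [a, b]: near x it comes from the
    difference quotient being within 1 of l, and at distance at least e from x
    from the bound 2M / e. *)
Lemma is_derive_in_lipschitz (R : realType) (a b M : R) (g : R -> R) (x l : R) :
  x \in `[a, b] -> (forall y, y \in `[a, b] -> `|g y| <= M) ->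
  is_derive_in a b g x l -> lipschitz_continuous_at a b g x.
Proof.
move=> xab gM /cvgrPdist_le/(_ _ ltr01).
move=> H; have {H} : \forall y \near x, y != x -> y \in `[a, b] ->
  `|l - diff_quotient g x y| <= 1 by [].
move=> /nbhs_ballP[e /= e0 H].
have M0 : 0 <= M := le_trans (normr_ge0 _) (gM _ xab).
exists (1 + `|l| + (M + M) / e) => _ [y [yx yab] <-].
have yx0 : 0 < `|y - x| by rewrite normr_gt0 subr_eq0.
rewrite powR_inv1; last exact: ltW.
have [yxe|yxe] := ltP `|y - x| e.
- have H' : `|l - diff_quotient g x y| <= 1.
    by apply: H => //; rewrite /ball/= distrC.
  rewrite -normfV -normrM -/(diff_quotient g x y).
  rewrite -[diff_quotient g x y](subKr l).
   apply: (le_trans (ler_normB _ _)); rewrite [1 + _]addrC.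
  apply: (@le_trans _ _ (`|l| + 1)); first by rewrite lerD2l.
  by rewrite lerDl divr_ge0 ?addr_ge0// ltW.
- apply: (@le_trans _ _ ((M + M) / e)); last by rewrite lerDr addr_ge0.
  apply: ler_pM => //.
    by apply: (le_trans (ler_normB _ _)); rewrite lerD// gM.
  by rewrite lef_pV2// posrE.
Qed.

(** * Taylor's formula with integral remainder *)

(** The Taylor polynomial of g 0 centred at u = sy + (1-s)x and evaluated at y,
    with g j standing for the j-th derivative; note y - u = (1-s)(y-x). It
    moves from the Taylor polynomial at x (s = 0) to g 0 y (s = 1). *)
Definition segment_taylor (R : realType) (g : nat -> R -> R) (x y : R)
    (m : nat) (s : R) : R :=
  \sum_(i < m.+1)
    ((1 - s) * (y - x)) ^+ i / i`!%:R * g i (s * y + (1 - s) * x).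

Lemma is_derive_segment (R : realType) (x y s : R) :
  is_derive s 1 (fun t => t * y + (1 - t) * x) (y - x).
Proof.
have H : is_derive s 1 (fun t : R => t * (y - x) + x) (y - x).
  by apply: is_derive_eq; rewrite /GRing.scale/=; ring.
apply: near_eq_is_derive H; near=> t; ring.
Unshelve. all: by end_near. Qed.

Lemma is_derive_weight (R : realType) (c s : R) (i : nat) :
  is_derive s 1 (fun t => ((1 - t) * c) ^+ i.+1 / i.+1`!%:R)
    (- (((1 - s) * c) ^+ i / i`!%:R * c)).
Proof.
have H : is_derive s 1 (fun t : R => (1 - t) * c) (- c).
  by apply: is_derive_eq; rewrite /GRing.scale/=; ring.
have H1 : is_derive s 1 (fun t : R => ((1 - t) * c) ^+ i.+1)
    (i.+1%:R * ((1 - s) * c) ^+ i * (- c)).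
  have := @is_deriveX _ _ _ i.+1 _ _ _ H; rewrite exprfctE => H1.
  by apply: is_derive_eq; rewrite /GRing.scale.
pose w : R := i.+1`!%:R^-1.
have H2 := is_deriveM H1 (is_derive_cst w s 1).
apply: (is_derive_eq H2).
rewrite /GRing.scale/= /w factS natrM; field.
by rewrite addrC natr1 !pnatr_eq0 -lt0n fact_gt0.
Qed.

(** The derivative of each term cancels against that of the next one, so only
    the top-order contribution survives. *)
Lemma is_derive_segment_taylor (R : realType) (g : nat -> R -> R) (x y : R)
    m s :
  (forall j, (j <= m)%N ->
     is_derive (s * y + (1 - s) * x) 1 (g j) (g j.+1 (s * y + (1 - s) * x))) ->
  is_derive s 1 (segment_taylor g x y m)
    (((1 - s) * (y - x)) ^+ m / m`!%:R * (y - x) *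
     g m.+1 (s * y + (1 - s) * x)).
Proof.
have gu j :
    is_derive (s * y + (1 - s) * x) 1 (g j) (g j.+1 (s * y + (1 - s) * x)) ->
    is_derive s 1 (fun t => g j (t * y + (1 - t) * x))
      (g j.+1 (s * y + (1 - s) * x) * (y - x)).
  move=> gj.
  exact: (@is_derive1_comp _ (g j) _ s _ _ gj (is_derive_segment x y s)).
elim: m => [|m IH] gd.
  have H := gu _ (gd 0%N (leqnn _)).
  rewrite (_ : segment_taylor g x y 0 = fun t => g 0%N (t * y + (1 - t) * x)).
    by apply: is_derive_eq; rewrite expr0 fact0 divr1 mul1r mulrC.
  apply/funext => t.
  by rewrite /segment_taylor big_ord1 expr0 fact0 divr1 mul1r.
have H := gu _ (gd _ (leqnn _)).
have H1 := is_derive_weight (y - x) s m.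
have H2 := IH (fun j jm => gd j (leqW jm)).
rewrite (_ : segment_taylor g x y m.+1 = fun t => segment_taylor g x y m t +
  ((1 - t) * (y - x)) ^+ m.+1 / m.+1`!%:R * g m.+1 (t * y + (1 - t) * x)).
  by apply: is_derive_eq; rewrite /GRing.scale/=; ring.
by apply/funext => t; rewrite /segment_taylor big_ord_recr.
Qed.

Lemma segment_in_itv (R : realType) (a b x y s : R) :
  x \in `[a, b] -> y \in `[a, b] -> s \in `[0, 1] ->
  s * y + (1 - s) * x \in `[a, b].
Proof.
rewrite !in_itv/= => /andP[ax xb] /andP[ay yb] /andP[s0 s1].
by apply/andP; split; nra.
Qed.

Lemma segment_in_itvoo (R : realType) (a b x y s : R) : x != y ->
  x \in `[a, b] -> y \in `[a, b] -> s \in `]0, 1[ ->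
  s * y + (1 - s) * x \in `]a, b[.
Proof.
rewrite !in_itv/= neq_lt => xy /andP[ax xb] /andP[ay yb] /andP[s0 s1].
by apply/andP; split; case/orP: xy => xy; nra.
Qed.

Lemma continuous_segment (R : realType) (a b x y : R) (g : R -> R) :
  x \in `[a, b] -> y \in `[a, b] -> {within `[a, b], continuous g} ->
  {within `[0, 1], continuous (fun s : R => g (s * y + (1 - s) * x))}.
Proof.
move=> xab yab /subspace_continuousP gc; apply/subspace_continuousP => s s01.
have uab := segment_in_itv xab yab s01.
apply: cvg_comp (gc _ uab) => U nU.
have nU' : \forall z \near s * y + (1 - s) * x, z \in `[a, b] -> U z by [].
suff : \forall t \near s, t \in `[0, 1] -> U (t * y + (1 - t) * x) by [].
have uc : t * y + (1 - t) * x @[t --> s] --> s * y + (1 - s) * x.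
  apply: cvgD; apply: cvgM; try exact: cvg_cst; first exact: cvg_id.
  by apply: cvgB; [exact: cvg_cst|exact: cvg_id].
have nV : \forall t \near s, t * y + (1 - t) * x \in `[a, b] ->
    U (t * y + (1 - t) * x) := uc _ nU'.
apply: filterS nV => t H t01; apply: H.
exact: segment_in_itv.
Qed.

Lemma continuous_remainder_integrand (R : realType) (a b x y : R)
    (g : R -> R) m :
  x \in `[a, b] -> y \in `[a, b] -> {within `[a, b], continuous g} ->
  {within `[0, 1], continuous
     (fun s : R => (1 - s) ^+ m * g (s * y + (1 - s) * x))}.
Proof.
move=> xab yab gc.
apply/subspace_continuousP => s s01; apply: cvgM.
  apply: cvg_within_filter.
  apply: (@cvg_comp _ _ _ (fun t => 1 - t) (fun z => z ^+ m)).
    by apply: cvgB; [exact: cvg_cst|exact: cvg_id].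
  exact: exprn_continuous.
by move/(continuous_segment xab yab)/subspace_continuousP: gc; exact.
Qed.

Lemma continuous_segment_taylor (R : realType) (a b x y : R)
    (g : nat -> R -> R) m :
  x \in `[a, b] -> y \in `[a, b] ->
  (forall j, (j <= m)%N -> {within `[a, b], continuous (g j)}) ->
  {within `[0, 1], continuous (segment_taylor g x y m)}.
Proof.
move=> xab yab gc.
apply/subspace_continuousP => s s01; apply: cvg_big.
 exact: add_continuous.
move=> i _.
 have := gc i (ltn_ord i) => /(continuous_segment xab yab).
move=> /subspace_continuousP/(_ _ s01) H.
apply: cvgM => //; apply: cvgM; last exact: cvg_cst.
apply: cvg_within_filter.
apply: (@cvg_comp _ _ _ (fun t => (1 - t) * (y - x)) (fun z => z ^+ i)).
  apply: cvgM; last exact: cvg_cst.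
  by apply: cvgB; [exact: cvg_cst|exact: cvg_id].
exact: exprn_continuous.
Qed.

(** The fundamental theorem of calculus on [0, 1] for [segment_taylor], which
    vanishes at s = 0 because x is flat. Parametrising by s makes the
    relative order of x and y irrelevant, and the points sy + (1-s)x with
    0 < s < 1 are interior to [a, b], where one-sided and two-sided
    derivatives agree. *)
Lemma taylor_integral (R : realType) (a b x y : R) (g : nat -> R -> R) m :
  x \in `[a, b] -> y \in `[a, b] -> x != y ->
  (forall j, (j <= m)%N -> forall z, z \in `[a, b] ->
     is_derive_in a b (g j) z (g j.+1 z)) ->
  {within `[a, b], continuous (g m.+1)} ->
  (forall j, (j <= m)%N -> g j x = 0) ->
  (y - x) ^+ m.+1 *
    \int[lebesgue_measure]_(s in `[0, 1])
       ((1 - s) ^+ m * g m.+1 (s * y + (1 - s) * x)) = m`!%:R * g 0%N y.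
Proof.
move=> xab yab xy gd gc gx.
(* scaling that removes the constant factors from the integrand *)
pose c := m`!%:R / (y - x) ^+ m.+1.
have yx0 : (y - x) ^+ m.+1 != 0 by rewrite expf_neq0// subr_eq0 eq_sym.
have f0 : m`!%:R != 0 :> R by rewrite pnatr_eq0 -lt0n fact_gt0.
pose F (s : R) := c * segment_taylor g x y m s.
have Fc : {within `[0, 1], continuous F}.
  have /subspace_continuousP H :
      {within `[0, 1], continuous (segment_taylor g x y m)}.
    apply: (continuous_segment_taylor xab yab) => // j jm.
    apply/subspace_continuousP => z zab.
    exact: is_derive_in_cvg (gd j jm z zab).
  apply/subspace_continuousP => s s01; apply: cvgM; first exact: cvg_cst.
  exact: H.
have Fd (s : R) : s \in `]0, 1[ -> is_derive s 1 F
    ((1 - s) ^+ m * g m.+1 (s * y + (1 - s) * x)).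
  move=> s01.
  have H := is_derive_segment_taylor (fun j jm =>
    is_derive_in_interior (segment_in_itvoo xy xab yab s01)
      (gd j jm _ (segment_in_itv xab yab (subset_itv_oo_cc s01)))).
  have := is_deriveZ c H => H1.
  apply: (is_derive_eq H1); rewrite /GRing.scale/= /c exprMn exprS; field.
  by rewrite f0 expf_neq0 subr_eq0 eq_sym.
rewrite /Rintegral (@continuous_FTC2 _ _ F) //=.
- rewrite /F /segment_taylor big_ord_recl big1 => [|i _]; last first.
    by rewrite subrr mul0r expr0n/= mul0r mul0r.
  rewrite [X in _ - (c * X)]big1 => [|i _]; last first.
    by rewrite mul0r add0r subr0 !mul1r gx ?mulr0// -ltnS.
  rewrite expr0 fact0 divr1 !mul1r subrr mul0r !addr0 mulr0 subr0.
  by rewrite /c; field.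
- exact: (continuous_remainder_integrand xab yab gc).
- have [H1 H2 H3] := (continuous_within_itvP _ ltr01).1 Fc.
  by split => // s /Fd[].
- by move=> s /Fd[_ <-]; rewrite derive1E.
Qed.

Lemma taylor_integral_le (R : realType) (a b x y alpha H : R) (g : R -> R) m :
  x \in `[a, b] -> y \in `[a, b] -> 0 <= H -> 0 <= alpha ->
  {within `[a, b], continuous g} ->
  (forall z, z \in `[a, b] -> `|g z| <= H * `|z - x| `^ alpha) ->
  `|\int[lebesgue_measure]_(s in `[0, 1])
       ((1 - s) ^+ m * g (s * y + (1 - s) * x))| <= H * `|y - x| `^ alpha.
Proof.
move=> xab yab H0 al0 gc gH.
have c1 : {within `[0, 1], continuous
    (fun s : R => (1 - s) ^+ m * g (s * y + (1 - s) * x))}.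
  exact: (continuous_remainder_integrand xab yab gc).
have i1 : lebesgue_measure.-integrable `[0, 1] (EFin \o
    (fun s : R => (1 - s) ^+ m * g (s * y + (1 - s) * x))).
  by apply: continuous_compact_integrable => //; exact: segment_compact.
apply: (le_trans (le_normr_Rintegral _ _)) => //.
have -> : H * `|y - x| `^ alpha =
    \int[lebesgue_measure]_(s in `[0, 1]) (H * `|y - x| `^ alpha).
  rewrite Rintegral_cst//= lebesgue_measure_itv/=.
  by rewrite lte_fin ltr01 oppr0 adde0/= mulr1.
apply: le_Rintegral => //.
- by have := integrable_norm i1.
- apply: continuous_compact_integrable; first exact: segment_compact.
  by apply: continuous_subspaceT => s; exact: cvg_cst.
- move=> s /= s01; rewrite normrM.
  have uab := segment_in_itv xab yab s01.
  move: s01; rewrite in_itv/= => /andP[s0 s1].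
  apply: (@le_trans _ _ (1 * (H * `|s * y + (1 - s) * x - x| `^ alpha))).
    apply: ler_pM => //; last exact: gH.
    by rewrite normrX exprn_ile1// ger0_norm ?subr_ge0// gerBl.
  rewrite mul1r ler_wpM2l// ge0_ler_powR ?nnegrE//.
  rewrite (_ : _ - x = s * (y - x)); last by ring.
  by rewrite normrM ger0_norm// ler_piMl.
Qed.

(** * Powers of a function with flat zeros *)

Lemma Ck_is_derive_in (R : realType) (a b : R) (f : R -> R) k j x :
  Ck k a b f -> (j < k)%N -> x \in `[a, b] ->
  is_derive_in a b (nderive_in a b j f) x (nderive_in a b j.+1 f x).
Proof. by move=> [fd _] jk xab; exact: fd. Qed.

(** An upper bound of the quotients can be negative when [a, b] has no two
    distinct points; its maximum with 0 also serves for x = y. *)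
Lemma hoelder_continuous_le (R : realType) (a b alpha : R) (g : R -> R) :
  hoelder_continuous a b alpha g ->
  exists2 H, 0 <= H & forall x y, x \in `[a, b] -> y \in `[a, b] ->
    `|g y - g x| <= H * `|y - x| `^ alpha.
Proof.
move=> [H Hub]; exists (Num.max H 0); first by rewrite le_max lexx orbT.
move=> x y xab yab; have [->|yx] := eqVneq y x.
  by rewrite subrr normr0 mulr_ge0 ?powR_ge0// le_max lexx orbT.
have yx0 : 0 < `|y - x| by rewrite normr_gt0 subr_eq0.
rewrite -ler_pdivrMr ?powR_gt0// -powRN le_max; apply/orP; left.
by apply: Hub; exists (y, x).
Qed.

(** In the integral remainder, the vanishing of the k-th derivative at x turns
    its Hoelder continuity into the bound H |z-x|^alpha at every z; this adds
    alpha to the order k of contact. *)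
Lemma flat_growth (R : realType) (a b alpha : R) (f : R -> R) k :
  (0 < k)%N -> 0 < alpha -> Ckalpha k alpha a b f ->
  exists2 H, 0 <= H & forall x y, x \in `[a, b] -> y \in `[a, b] ->
    (forall j, (j <= k)%N -> nderive_in a b j f x = 0) ->
    `|f y| <= H * `|y - x| `^ (k%:R + alpha).
Proof.
case: k => // k _ al0 [fk /hoelder_continuous_le[H H0 fH]].
exists H => // x y xab yab fx.
have [<-|xy] := eqVneq x y.
  by rewrite [f x](fx 0%N)// normr0 mulr_ge0 ?powR_ge0.
have gd j : (j <= k)%N -> forall z, z \in `[a, b] ->
    is_derive_in a b (nderive_in a b j f) z (nderive_in a b j.+1 f z).
  by move=> jk z zab; exact: Ck_is_derive_in fk _ zab.
have := taylor_integral (g := fun j => nderive_in a b j f) xab yab xy gd fk.2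
   (fun j jk => fx j (leqW jk)).
have gH z : z \in `[a, b] ->
    `|nderive_in a b k.+1 f z| <= H * `|z - x| `^ alpha.
  by move=> zab; have := fH x z xab zab; rewrite (fx k.+1)// subr0.
have I := taylor_integral_le k xab yab H0 (ltW al0) fk.2 gH.
move=> E; apply: (@le_trans _ _ `|k`!%:R * f y|).
  by rewrite normrM ler_peMl// normr_nat ler1n fact_gt0.
rewrite -[f y]/(nderive_in a b 0 f y) -E normrM powRD; last first.
  by rewrite normr_eq0 subr_eq0 [y == x]eq_sym xy implybT.
by rewrite powR_mulrn// mulrCA normrX ler_wpM2l.
Qed.

Lemma is_derive_in_powR (R : realType) (a b mu : R) (f : R -> R) (x l : R) :
  0 < f x -> is_derive_in a b f x l ->
  is_derive_in a b (fun t => f t `^ mu) x (mu * f x `^ (mu - 1) * l).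
Proof.
move=> fx fl.
exact: (is_derive_in_comp (h := fun z => z `^ mu) (is_derive_in_cvg fl)
  (is_derive1_powR mu fx) fl).
Qed.

(** The difference quotient at x is at most C |y-x|^(mu K - 1), a positive
    power of the distance. *)
Lemma is_derive_in_powR_flat (R : realType) (a b mu K H : R) (f : R -> R)
    (x : R) :
  x \in `[a, b] -> 0 < mu -> 1 < mu * K ->
  (forall y, y \in `[a, b] -> 0 <= f y <= H * `|y - x| `^ K) ->
  is_derive_in a b (fun t => f t `^ mu) x 0.
Proof.
move=> xab mu0 muK fH.
have K0 : K != 0 by apply: contraTneq muK => ->; rewrite mulr0 ltr10.
have fx : f x = 0.
  apply/eqP; rewrite eq_le andbC; have := fH x xab.
  by rewrite subrr normr0 powR0// mulr0.
pose C := (`|H| + 1) `^ mu.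
have C0 : 0 < C by rewrite powR_gt0// ltr_wpDl.
have be0 : 0 < mu * K - 1 by rewrite subr_gt0.
apply/cvgrPdist_le => e e0.
pose d := (e / C) `^ (mu * K - 1)^-1.
have d0 : 0 < d by rewrite powR_gt0// divr_gt0.
(* d is the radius at which C d^(mu K - 1) equals e *)
suff : \forall y \near x, y != x -> y \in `[a, b] ->
  `|0 - diff_quotient (fun t => f t `^ mu) x y| <= e by [].
have : \forall y \near x, `|y - x| < d.
  by apply/nbhs_ballP; exists d => //= y; rewrite /ball/= distrC.
apply: filterS => y yd yx yab.
have yx0 : 0 < `|y - x| by rewrite normr_gt0 subr_eq0.
rewrite sub0r normrN /diff_quotient fx powR0 ?gt_eqF// subr0 normrM normfV.
rewrite ler_pdivrMr// ger0_norm ?powR_ge0//.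
have /andP[fy0 fyH] := fH y yab.
apply: (@le_trans _ _ (C * `|y - x| `^ (mu * K))).
  rewrite [mu * K]mulrC powRrM -powRM ?powR_ge0//.
  apply: ge0_ler_powR; [exact: ltW|by []|by rewrite nnegrE mulr_ge0 ?powR_ge0|].
  apply: (le_trans fyH); rewrite ler_wpM2r ?powR_ge0//.
  by apply: (le_trans (ler_norm _)); rewrite lerDl.
have -> : mu * K = (mu * K - 1) + 1 by rewrite subrK.
rewrite powRD; last by rewrite (gt_eqF yx0) implybT.
rewrite powRr1; last exact: ltW.
rewrite mulrA ler_wpM2r//.
rewrite mulrC -ler_pdivlMr//.
have -> : e / C = d `^ (mu * K - 1).
  by rewrite /d -powRrM mulVf ?gt_eqF// powRr1// ltW// divr_gt0.
by apply: ge0_ler_powR; rewrite ?nnegrE// ltW.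
Qed.

(** Taylor's formula for f and for f' identifies Dterm and Nterm with powers
    and multiples of f y and f' y. *)
Lemma bounded_quotient_deriv_le (R : realType) (a b alpha : R) (f : R -> R) k :
  (2 <= k)%N -> Ck k a b f ->
  forall M x y, x \in `[a, b] -> y \in `[a, b] ->
    (forall j, (j <= k)%N -> nderive_in a b j f x = 0) -> 0 < f y ->
    `|Nterm k (nderive_in a b k f) x y /
      Dterm k alpha (nderive_in a b k f) x y| <= M ->
    `|derive_in a b f y| <=
      M * (k.-1)`!%:R `^ ((k%:R + alpha - 1) / (k%:R + alpha)) *
      f y `^ ((k%:R + alpha - 1) / (k%:R + alpha)).
Proof.
case: k => [|[|n]]// _ fk M x y xab yab fx fy.
have xy : x != y by apply: contraTneq fy => <-; rewrite [f x](fx 0%N)// ltxx.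
have D0 := taylor_integral (g := fun j => nderive_in a b j f) xab yab xy
  (fun j jk z => @Ck_is_derive_in R a b f n.+2 j z fk jk) fk.2
  (fun j jk => fx j (leqW jk)).
have D1 := taylor_integral (g := fun j => nderive_in a b j.+1 f) xab yab xy
  (fun j jk z => @Ck_is_derive_in R a b f n.+2 j.+1 z fk jk) fk.2
  (fun j jk => fx j.+1 (leqW jk)).
rewrite /Nterm /Dterm !subSS !subn0 D0 D1 /=.
set th := (_ - 1) / _.
have f0 : 0 < n.+1`!%:R `^ th :> R by rewrite powR_gt0// ltr0n fact_gt0.
rewrite powRM //; last exact: ltW.
rewrite normrM normfV [X in _ / X]ger0_norm; last by rewrite mulr_ge0 ?powR_ge0.
rewrite ler_pdivrMr ?mulr_gt0 ?powR_gt0// mulrA; apply: le_trans.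
by rewrite normrM ler_peMl// normr_nat ler1n fact_gt0.
Qed.

Theorem mainTheorem1 (R : realType) (T : R) (k : nat) (alpha : R) (f : R -> R)
    (T_gt0 : 0 < T) (k_ge2 : (2 <= k)%N)
    (alpha_gt0 : 0 < alpha) (alpha_le1 : alpha <= 1)
    (f_Ckalpha : Ckalpha k alpha 0 T f)
    (f_ge0 : forall x, x \in `[0, T] -> 0 <= f x)
    (f_zero : exists2 x, x \in `[0, T] & f x = 0)
    (f_flat : forall x, x \in `[0, T] -> f x = 0 ->
       forall j, (1 <= j <= k)%N -> nderive_in 0 T j f x = 0) :
  (forall mu : R, 1 / (k%:R + alpha) < mu < 1 ->
     forall x, x \in `[0, T] -> derivable_in 0 T (fun t => f t `^ mu) x) /\
  ([bounded Nterm k (nderive_in 0 T k f) p.1 p.2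
            / Dterm k alpha (nderive_in 0 T k f) p.1 p.2
     | p in [set t | t \in `[0, T] /\ f t = 0]
            `*` [set t | t \in `[0, T] /\ 0 < f t]] ->
   forall mu : R, 1 / (k%:R + alpha) < mu < 1 ->
     (mu * (k%:R + alpha) - 1 <= 1 ->
      forall x, x \in `[0, T] -> f x = 0 ->
        hoelder_continuous_at 0 T (mu * (k%:R + alpha) - 1)
          (derive_in 0 T (fun t => f t `^ mu)) x) /\
     (forall x, x \in `[0, T] -> 0 < f x ->
        lipschitz_continuous_at 0 T (derive_in 0 T (fun t => f t `^ mu)) x)).
Proof.
set K := k%:R + alpha.
have K0 : 0 < K by rewrite ltr_wpDl.
have k0 : (0 < k)%N := ltnW k_ge2.
have flat x : x \in `[0, T] -> f x = 0 ->
    forall j, (j <= k)%N -> nderive_in 0 T j f x = 0.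
  by move=> xT fx [|j] jk; [exact: fx|exact: f_flat].
have [H H0 fH] := flat_growth k0 alpha_gt0 f_Ckalpha.
have grow x y : x \in `[0, T] -> y \in `[0, T] -> f x = 0 ->
    0 <= f y <= H * `|y - x| `^ K.
  move=> xT yT fx; rewrite f_ge0//=.
  exact: le_trans (ler_norm _) (fH x y xT yT (flat x xT fx)).
have d1 x : x \in `[0, T] -> is_derive_in 0 T f x (derive_in 0 T f x).
  by move=> xT; exact: (@Ck_is_derive_in _ _ _ _ k 0 _ f_Ckalpha.1).
have dpos mu x : x \in `[0, T] -> 0 < f x ->
    is_derive_in 0 T (fun t => f t `^ mu) x
      (mu * f x `^ (mu - 1) * derive_in 0 T f x).
  by move=> xT fx; apply: is_derive_in_powR => //; exact: d1.
have dzero mu x : 1 / K < mu -> x \in `[0, T] -> f x = 0 ->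
    is_derive_in 0 T (fun t => f t `^ mu) x 0.
  move=> Kmu xT fx; apply: (@is_derive_in_powR_flat _ _ _ _ K H) => //.
  - by apply: lt_trans Kmu; rewrite divr_gt0.
  - by rewrite -ltr_pdivrMr.
  - by move=> y yT; exact: grow.
have zero_or_pos x : x \in `[0, T] -> f x = 0 \/ 0 < f x.
  move=> xT; have := f_ge0 x xT; rewrite le_eqVlt => /orP[/eqP|]; last by right.
  by move=> <-; left.
split=> [mu /andP[Kmu _] x xT|[M0 [_ bd]] mu /andP[Kmu mu1]].
  case: (zero_or_pos x xT) => fx.
    exact: (is_derive_inP T_gt0 xT (dzero mu x Kmu xT fx)).1.
  exact: (is_derive_inP T_gt0 xT (dpos mu x xT fx)).1.
have mu0 : 0 < mu by apply: lt_trans Kmu; rewrite divr_gt0.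
(* [bounded] only gives a bound by every constant strictly above M0 *)
pose M := Num.max (M0 + 1) 0.
have M_ge0 : 0 <= M by rewrite le_max lexx orbT.
pose th := (K - 1) / K.
pose C := mu * (M * (k.-1)`!%:R `^ th).
have C0 : 0 <= C by rewrite !mulr_ge0 ?powR_ge0// ltW.
pose be := mu * K - 1.
have be0 : 0 < be by rewrite subr_gt0 -ltr_pdivrMr.
have muth : mu - 1 + th = be / K by rewrite /th /be; field; rewrite gt_eqF.
have [x0 x0T fx0] := f_zero.
have dzeroE x : x \in `[0, T] -> f x = 0 ->
    derive_in 0 T (fun t => f t `^ mu) x = 0.
  by move=> xT fx; apply: (is_derive_inP T_gt0 xT (dzero mu x Kmu xT fx)).2.
have dposE x : x \in `[0, T] -> 0 < f x ->
    derive_in 0 T (fun t => f t `^ mu) x =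
    mu * f x `^ (mu - 1) * derive_in 0 T f x.
  by move=> xT fx; apply: (is_derive_inP T_gt0 xT (dpos mu x xT fx)).2.
have dle y : y \in `[0, T] ->
    `|derive_in 0 T (fun t => f t `^ mu) y| <= C * f y `^ (be / K).
  move=> yT; case: (zero_or_pos y yT) => fy.
    by rewrite dzeroE// normr0 mulr_ge0 ?powR_ge0.
  rewrite dposE// normrM ger0_norm; last by rewrite mulr_ge0 ?powR_ge0 ?ltW.
  have bdy : `|Nterm k (nderive_in 0 T k f) x0 y /
                Dterm k alpha (nderive_in 0 T k f) x0 y| <= M.
    by apply: (bd M _ (x0, y)); [rewrite lt_max ltrDl ltr01|split].
  have := bounded_quotient_deriv_le k_ge2 f_Ckalpha.1 x0T yT
    (flat x0 x0T fx0) fy bdy.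
  rewrite -/K -/th => H1.
  rewrite (_ : C * _ =
      mu * f y `^ (mu - 1) * (M * (k.-1)`!%:R `^ th * f y `^ th)).
    by rewrite ler_wpM2l// mulr_ge0 ?powR_ge0// ltW.
  by rewrite /C -muth [f y `^ (_ + th)]powRD ?(gt_eqF fy) ?implybT//; ring.
have dH x y : x \in `[0, T] -> y \in `[0, T] -> f x = 0 ->
    `|derive_in 0 T (fun t => f t `^ mu) y| <=
      C * H `^ (be / K) * `|y - x| `^ be.
  move=> xT yT fx; apply: (le_trans (dle y yT)); rewrite -mulrA ler_wpM2l//.
  have /andP[fy0 fyH] := grow x y xT yT fx.
  have -> : `|y - x| `^ be = (`|y - x| `^ K) `^ (be / K).
    by rewrite -powRrM mulrC divfK ?gt_eqF.
  rewrite -powRM ?powR_ge0//; apply: ge0_ler_powR => //.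
  - by rewrite divr_ge0// ltW.
  - by rewrite nnegrE mulr_ge0 ?powR_ge0.
split=> [_ x xT fx|x xT fx].
  exists (C * H `^ (be / K)) => _ [y [yx yT] <-].
  rewrite (dzeroE x)// subr0 powRN ler_pdivrMr; last first.
    by rewrite powR_gt0// normr_gt0 subr_eq0.
  exact: dH.
pose L := C * H `^ (be / K) * T `^ be.
have gL y : y \in `[0, T] -> `|derive_in 0 T (fun t => f t `^ mu) y| <= L.
  move=> yT; apply: (le_trans (dH x0 y x0T yT fx0)).
  apply: ler_wpM2l; first by rewrite mulr_ge0 ?powR_ge0.
  apply: ge0_ler_powR; [exact: ltW|by []|by rewrite nnegrE ltW|].
  move: x0T yT; rewrite !in_itv/= => /andP[? ?] /andP[? ?].
  by rewrite ler_norml; apply/andP; split; lra.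
(* as k >= 2, f' is itself differentiable at x *)
have d2 : is_derive_in 0 T (derive_in 0 T f) x (nderive_in 0 T 2 f x).
  exact: (@Ck_is_derive_in _ _ _ _ k 1 _ f_Ckalpha.1).
have dg := is_derive_inM (is_derive_inM
  (is_derive_in_cst 0 T mu x) (dpos (mu - 1) x xT fx)) d2.
apply: (is_derive_in_lipschitz xT gL).
apply: (near_is_derive_in _ _ dg); last by rewrite dposE.
have fc := is_derive_in_cvg (d1 x xT).
have fpos : \forall y \near x, y \in `[0, T] -> 0 < f y.
  exact: (fc _ (lt_nbhsr fx)).
apply: filterS fpos => y fy yT; by rewrite [RHS]dposE ?fy.
Qed.
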